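(* Let $A$ be a preorder. The preorder $Alg(A)$, together with the order-preserving map $j_A:A\to Alg(A)$ sending $a$ to the downset generated by $a$, is such that for any preorder $B$ having least upper bounds of all non-empty directed subsets and any order-preserving map $f:A\to B$, there is a unique map $\bar f: Alg(A)\to B$ preserving least upper bounds of non-empty directed sets and satisfying $\bar f\circ j_A = f$.
   Context: $Alg(A)$ is the algebraic (ideal) completion of $A$: the set of non-empty directed downward closed subsets (downsets) of $A$ ordered by inclusion. A subset is directed if every finite family of its elements has an upper bound in it. The downset generated by $a$ is $\{x\in A\mid x\le a\}$.
   Formalization: The equation f̄∘j_A = f and the uniqueness of f̄ are stated up to equivalence in B (x ≤ y and y ≤ x) rather than literal equality, since with literal equality the claim fails for preorders B that are not posets; for a poset B it is the literal claim. *)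

(* Defs.v *)
From HB Require Import structures.
From mathcomp Require Import all_boot all_order.
From mathcomp Require Import boolp classical_sets functions cardinality.

Set Implicit Arguments.
Unset Strict Implicit.
Unset Printing Implicit Defensive.

Import Order.TTheory.

Local Open Scope classical_set_scope.
Local Open Scope order_scope.

Section Preorders.
Context {d : Order.disp_t} {T : preorderType d}.
Implicit Types (D : set T) (x y : T).

(* [ubound] and [isLub] of [classical_sets] require antisymmetry. *)
Definition upper_bound D x : Prop := forall y, D y -> y <= x.

Definition is_lub D x : Prop :=
  upper_bound D x /\ forall y, upper_bound D y -> x <= y.

Definition directed D : Prop :=
  forall F : set T, finite_set F -> F `<=` D ->
    exists2 x, D x & upper_bound F x.

Definition downset D : Prop := forall x y, D y -> x <= y -> D x.

Definition has_directed_lubs : Prop :=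
  forall D, D !=set0 -> directed D -> exists x, is_lub D x.

(* Equality of elements of a preorder. Least upper bounds in a preorder are
   determined only up to this relation. *)
Definition order_equiv x y : Prop := x <= y /\ y <= x.

End Preorders.

Arguments has_directed_lubs {d} T.

Lemma order_equivP d (T : porderType d) (x y : T) : order_equiv x y <-> x = y.
Proof.
split=> [[xy yx]|->]; last by split.
by apply/eqP; rewrite eq_le xy yx.
Qed.

Definition preserves_directed_lubs d (S : preorderType d)
    d' (T : preorderType d') (g : S -> T) : Prop :=
  forall (D : set S) (x : S),
    D !=set0 -> directed D -> is_lub D x -> is_lub (g @` D) (g x).

Definition order_equiv_fun (S : Type) d (T : preorderType d)
    (g h : S -> T) : Prop :=
  forall x, order_equiv (g x) (h x).

Section AlgebraicCompletion.
Context {d : Order.disp_t} (A : preorderType d).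

Definition ideals : set (set A) :=
  [set I | [/\ I !=set0, directed I & downset I]].

Definition Alg : Type := set_type ideals.

HB.instance Definition _ := SubChoice.on Alg.
HB.instance Definition _ := [SubChoice_isSubPOrder of Alg by <: with set_display].

Lemma Alg_leP (I J : Alg) : reflect (val I `<=` val J) (I <= J).
Proof. exact: asboolP. Qed.

Definition principal (a : A) : set A := [set x | x <= a].

Lemma principal_ideal (a : A) : principal a \in ideals.
Proof.
rewrite inE; split.
- by exists a; rewrite /principal /=.
- by move=> F _ Fa; exists a; rewrite /principal /=.
- by move=> x y /= ya xy; exact: le_trans xy ya.
Qed.

Definition j_A (a : A) : Alg := exist _ (principal a) (principal_ideal a).

Lemma j_A_homo : {homo j_A : a b / a <= b}.
Proof. by move=> a b ab; apply/Alg_leP => x /= xa; exact: le_trans xa ab. Qed.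

HB.instance Definition _ := Order.isOrderMorphism.Build d A set_display Alg j_A j_A_homo.

End AlgebraicCompletion.

(* Main.v *)
Require Import Defs.
From mathcomp Require Import all_boot all_order.
From mathcomp Require Import boolp classical_sets functions cardinality.

Set Implicit Arguments.
Unset Strict Implicit.
Unset Printing Implicit Defensive.

Import Order.TTheory.

(** Every ideal [I] is the directed least upper bound of the principal ideals
    [j_A a], [a] in [I], so an extension of [f] that preserves directed least
    upper bounds must send [I] to a least upper bound of [f @` I]; choosing one
    for each [I] defines [fbar]. It preserves directed least upper bounds
    because these are unions in [Alg A]. *)

Local Open Scope classical_set_scope.
Local Open Scope order_scope.

(** The empty family accounts for non-emptiness; conversely, bounds for pairs give bounds for finite
    families by induction on an enumerating list, with [x0] bounding the empty one. *)
Lemma directedP d (T : preorderType d) (D : set T) :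
  directed D <->
  D !=set0 /\ forall x y, D x -> D y -> exists z, [/\ D z, x <= z & y <= z].
Proof.
split=> [dirD|[[x0 Dx0] dirD] F /finite_seqP[s ->{F}]].
- split.
    by have [x Dx _] := dirD set0 (finite_set0 _) (@sub0set _ _); exists x.
  move=> x y Dx Dy; have [||z Dz ubz] := dirD [set x; y].
  + exact: finite_set2.
  + by move=> _ [->|->].
  + by exists z; split=> //; apply: ubz; [left|right].
- elim: s => [|x s IHs] sD; first by exists x0.
  have [y sy|y Dy uby] := IHs; first by apply: sD; rewrite /= inE [y \in s]sy orbT.
  have Dx : D x by apply: sD; rewrite /= mem_head.
  have [z [Dz xz yz]] := dirD _ _ Dx Dy.
  exists z => // t /=; rewrite inE => /orP[/eqP -> //|ts].
  exact: le_trans (uby _ ts) yz.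
Qed.

Lemma directed_image d (S : preorderType d) d' (T : preorderType d')
    (f : S -> T) (D : set S) :
  {homo f : x y / x <= y} -> directed D -> directed (f @` D).
Proof.
move=> homo_f /directedP[[x0 Dx0] dirD]; apply/directedP; split.
  by exists (f x0), x0.
move=> _ _ [x Dx <-] [y Dy <-]; have [z [Dz xz yz]] := dirD _ _ Dx Dy.
by exists (f z); split; [exists z|exact: homo_f..].
Qed.

Lemma is_lub_order_equiv d (T : preorderType d) (D : set T) (x y : T) :
  is_lub D x -> is_lub D y -> order_equiv x y.
Proof. by move=> [ubx lex] [uby ley]; split; [exact: lex|exact: ley]. Qed.

(** Allows [f] to stand in for [g \o j_A] in the uniqueness proof, where the two agree only up to
    [order_equiv]. *)
Lemma is_lub_image_order_equiv (S : Type) d (T : preorderType d) (f g : S -> T)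
    (D : set S) (x : T) :
  order_equiv_fun f g -> is_lub (f @` D) x -> is_lub (g @` D) x.
Proof.
move=> fg [ubx lex]; split=> [_ [y Dy <-]|z ubz].
  by apply: le_trans (fg y).2 _; apply: ubx; exists y.
by apply: lex => _ [y Dy <-]; apply: le_trans (fg y).1 _; apply: ubz; exists y.
Qed.

Section AlgTheory.
Context {d : Order.disp_t} {A : preorderType d}.
Implicit Types (I J : Alg A) (D : set (Alg A)).

Lemma Alg_ideal I : [/\ val I !=set0, directed (val I) & downset (val I)].
Proof. by have := valP I; rewrite inE. Qed.

Lemma j_A_le (a : A) I : val I a -> j_A a <= I.
Proof.
by move=> Ia; apply/Alg_leP => x xa; have [_ _ dI] := Alg_ideal I; exact: dI xa.
Qed.

(** By reflexivity [a] belongs to [j_A a], hence to every ideal above [j_A a]. *)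
Lemma is_lub_j_A I : is_lub (@j_A d A @` val I) I.
Proof.
split=> [_ [a Ia <-]|J ubJ]; first exact: j_A_le.
apply/Alg_leP => a Ia; have /Alg_leP : j_A a <= J by apply: ubJ; exists a.
by apply; exact: lexx.
Qed.

(** Two elements of the union come from ideals [I] and [J] of [D]; both lie in a common [K] of [D],
    which contains a bound for them. *)
Lemma bigcup_ideal D : directed D -> \bigcup_(I in D) val I \in @ideals d A.
Proof.
move=> /directedP[[I0 DI0] dirD]; rewrite inE.
have U0 : \bigcup_(I in D) val I !=set0.
  by have [[a I0a] _ _] := Alg_ideal I0; exists a, I0.
split=> //.
- apply/directedP; split=> // x y [I DI Ix] [J DJ Jy].
  have [K [DK /Alg_leP IK /Alg_leP JK]] := dirD _ _ DI DJ.
  have [_ /directedP[_ dirK] _] := Alg_ideal K.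
  have [z [Kz xz yz]] := dirK _ _ (IK _ Ix) (JK _ Jy).
  by exists z; split=> //; exists K.
- move=> x y [I DI Iy] xy; exists I => //.
  by have [_ _ dI] := Alg_ideal I; exact: dI xy.
Qed.

(** The union is an ideal that bounds [D] from above, so the least upper bound lies below it. *)
Lemma is_lub_bigcup D I :
  directed D -> is_lub D I -> val I `<=` \bigcup_(J in D) val J.
Proof.
move=> dirD [_ leI].
pose U : Alg A := exist _ (\bigcup_(J in D) val J) (bigcup_ideal dirD).
suff /Alg_leP : I <= U by [].
by apply: leI => J DJ; apply/Alg_leP => a Ja; exists J.
Qed.

Section Extension.
Context {d' : Order.disp_t} {B : preorderType d'} (f : A -> B).
Variable fbar : Alg A -> B.
Hypothesis fbarP : forall I, is_lub (f @` val I) (fbar I).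

Lemma lub_extension_homo : {homo fbar : I J / I <= J}.
Proof.
move=> I J /Alg_leP IJ; apply: (fbarP I).2 => _ [a Ia <-].
by apply: (fbarP J).1; exists a => //; exact: IJ.
Qed.

Lemma lub_extension_preserves : preserves_directed_lubs fbar.
Proof.
move=> D I _ dirD lubI; split=> [_ [J DJ <-]|b ubb].
  exact: lub_extension_homo (lubI.1 _ DJ).
apply: (fbarP I).2 => _ [a Ia <-].
(* Since [a] already lies in a member [J] of [D], [f a <= fbar J <= b]. *)
have [J DJ Ja] := is_lub_bigcup dirD lubI Ia.
by apply: (@le_trans _ _ (fbar J)); [apply: (fbarP J).1; exists a|apply: ubb; exists J].
Qed.

(** By monotonicity [f a] is the greatest element of the image of [principal a], hence a least upper
    bound of it. *)
Lemma lub_extension_j_A :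
  {homo f : a b / a <= b} -> order_equiv_fun (fbar \o @j_A d A) f.
Proof.
move=> homo_f a; apply: is_lub_order_equiv (fbarP (j_A a)) _.
split=> [_ [x xa <-]|b ubb]; first exact: homo_f.
by apply: ubb; exists a => //; exact: lexx.
Qed.

Lemma lub_extension_unique (g : Alg A -> B) :
  preserves_directed_lubs g -> order_equiv_fun (g \o @j_A d A) f ->
  order_equiv_fun g fbar.
Proof.
move=> pg gf I; have [[a Ia] dirI _] := Alg_ideal I.
apply: is_lub_order_equiv (fbarP I); apply: is_lub_image_order_equiv gf _.
(* The image under [g \o j_A] is seen as the [g]-image of the directed set of principal ideals below
   [I], whose least upper bound [g] preserves. *)
rewrite -image_comp; apply: pg (is_lub_j_A I); first by exists (j_A a), a.
by apply: directed_image dirI; exact: j_A_homo.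
Qed.

End Extension.
End AlgTheory.

Theorem theorem4p3 (d : Order.disp_t) (A : preorderType d) :
  {homo @j_A d A : a b / (a <= b)%O} /\
  forall (d' : Order.disp_t) (B : preorderType d') (f : {omorphism A -> B}),
    has_directed_lubs B ->
    exists fbar : Alg A -> B,
      [/\ preserves_directed_lubs fbar,
          order_equiv_fun (fbar \o @j_A d A) f
        & forall g : Alg A -> B,
            preserves_directed_lubs g ->
            order_equiv_fun (g \o @j_A d A) f ->
            order_equiv_fun g fbar].
Proof.
split=> [|d' B f lubB]; first exact: j_A_homo.
have homo_f : {homo f : a b / a <= b} by exact: omorph_le.
(* Least upper bounds in a preorder are not unique, so selecting one for every ideal uses the axiom
   of choice. *)
have /choice[fbar fbarP] (I : Alg A) : exists b, is_lub (f @` val I) b.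
  have [[a Ia] dirI _] := Alg_ideal I.
  by apply: lubB; [exists (f a), a|exact: directed_image dirI].
exists fbar; split.
- exact: lub_extension_preserves fbarP.
- exact: lub_extension_j_A fbarP homo_f.
- exact: lub_extension_unique fbarP.
Qed.
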